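(* Let $\beta>0$, $0<d\le1$ and $\epsilon,\kappa>0$. Let $s_\beta(z)=\frac1m\operatorname{tr}(M_{\beta,d}-z)^{-1}$ and $s_\infty(z)=\frac1m\operatorname{tr}(M_{\infty,d}-z)^{-1}$, where $M_{\beta,d}$ is the normalized $m\times m$ $\beta$-Laguerre matrix and $M_{\infty,d}$ is its deterministic counterpart. For any $z$ such that $\Im z>m^{-1/4+\epsilon}$ and $\lambda_-+\kappa<\Re z<\lambda_+-\kappa$, we have \[ |s_\beta(z)-s_\infty(z)|=O_{\epsilon,\kappa}(m^{-\epsilon/8}) \] with overwhelming probability. That is, there is a constant $C_{\epsilon,\kappa}$ such that for every $k>0$ there is a constant $C_k$ with \[ \mathbb{P}\big(|s_\beta(z)-s_\infty(z)|> C_{\epsilon,\kappa}\,m^{-\epsilon/8}\big)\le C_k\,m^{-k} \] for all $m$ and all such $z$ (the constants may depend on the fixed $\beta,d,\epsilon,\kappa$, but not on $m$ or $z$).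
   Context: $\chi_r$ ($r>0$) denotes a random variable with the chi distribution with $r$ degrees of freedom, i.e. with density $\frac{2^{1-r/2}}{\Gamma(r/2)}x^{r-1}e^{-x^2/2}$ on $(0,\infty)$. For $\beta>0$, $0<d\le1$, $m\in\mathbb{N}$, $B_\beta$ is the random real $m\times m$ lower bidiagonal matrix with all nonzero entries independent, with $(B_\beta)_{jj}\sim\chi_{m\beta/d-\beta(j-1)}$ for $1\le j\le m$, $(B_\beta)_{j+1,j}\sim\chi_{\beta(m-j)}$ for $1\le j\le m-1$, and all other entries $0$. The normalized $\beta$-Laguerre matrix is $M_{\beta,d}=\frac{d}{\beta m}B_\beta B_\beta^t$. $M_{\infty,d}$ is the deterministic real symmetric tridiagonal $m\times m$ matrix with $(M_{\infty,d})_{11}=\frac dm\cdot\frac md=1$, $(M_{\infty,d})_{jj}=\frac dm\left(\frac md+m-2j+2\right)$ for $2\le j\le m$, and $(M_{\infty,d})_{j,j+1}=(M_{\infty,d})_{j+1,j}=\frac dm\sqrt{\frac md-j+1}\,\sqrt{m-j}$ for $1\le j\le m-1$. $\lambda_\pm=(1\pm\sqrt d)^2$. *)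

(* Defs.v *)
From HB Require Import structures.
From mathcomp Require Import all_boot all_order all_algebra.
From mathcomp Require Import complex.
From mathcomp Require Import all_classical all_reals all_analysis.

Set Implicit Arguments.
Unset Strict Implicit.
Unset Printing Implicit Defensive.

Import Order.TTheory GRing.Theory Num.Theory.

Local Open Scope classical_set_scope.
Local Open Scope ring_scope.
Local Open Scope complex_scope.

Definition Gamma_fun {R : realType} (a : R) : R :=
  \int[lebesgue_measure]_(t in `]0, +oo[) (t `^ (a - 1) * expR (- t)).

Definition chi_pdf {R : realType} (r x : R) : R :=
  if 0 < x then
    2 `^ (1 - r / 2) / Gamma_fun (r / 2) * x `^ (r - 1) * expR (- (x ^+ 2 / 2))
  else 0.

Definition chi_distributed {R : realType} {disp : measure_display}
    {T : measurableType disp} {P : probability T R} (X : {RV P >-> R}) (r : R) :=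
  forall A : set R, measurable A ->
    distribution P X A = (\int[lebesgue_measure]_(x in A) (chi_pdf r x)%:E)%E.

Definition mutually_independent {R : realType} {disp : measure_display}
    {T : measurableType disp} {P : probability T R} {I : finType}
    (D : {set I}) (X : I -> {RV P >-> R}) :=
  forall (J : {set I}) (A : I -> set R), J \subset D ->
    (forall i, i \in J -> measurable (A i)) ->
    P (\bigcap_(i in [set i | i \in J]) (X i @^-1` A i)) =
    (\prod_(i in J) P (X i @^-1` A i))%E.

(* Indices are 0-based: row/column i here is row/column i + 1 in the usual
   1-based description, so that for instance chi_(m beta / d - beta (j - 1))
   on the diagonal becomes chi_(m beta / d - beta j). *)

Definition bidiag_support (m : nat) : {set 'I_m * 'I_m} :=
  [set ij : 'I_m * 'I_m |
     (ij.1 == ij.2) || (nat_of_ord ij.1 == (nat_of_ord ij.2).+1)]%SET.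

Record beta_bidiagonal {R : realType} {disp : measure_display}
    {T : measurableType disp} {P : probability T R} (beta d : R) (m : nat)
    (B : 'I_m -> 'I_m -> {RV P >-> R}) : Prop := {
  bidiag_diag : forall j : 'I_m,
    chi_distributed (B j j) (m%:R * beta / d - beta * j%:R) ;
  bidiag_sub : forall i j : 'I_m, nat_of_ord i = j.+1 ->
    chi_distributed (B i j) (beta * (m%:R - j.+1%:R)) ;
  bidiag_zero : forall i j : 'I_m, (i, j) \notin bidiag_support m ->
    forall w : T, B i j w = 0 ;
  bidiag_indep : mutually_independent (bidiag_support m)
    (fun ij : 'I_m * 'I_m => B ij.1 ij.2) }.

Definition laguerre_mx {R : realType} (beta d : R) (m : nat) (B : 'M[R]_m) :
    'M[R]_m :=
  (d / (beta * m%:R)) *: (B *m B^T).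

Definition laguerre_infty_mx {R : realType} (d : R) (m : nat) : 'M[R]_m :=
  let offdiag (j : nat) :=
    d / m%:R * Num.sqrt (m%:R / d - j%:R) * Num.sqrt (m%:R - j.+1%:R) in
  \matrix_(i < m, j < m)
    if i == j then
      if nat_of_ord j == 0%N then 1
      else d / m%:R * (m%:R / d + m%:R - 2 * j%:R)
    else if nat_of_ord j == i.+1 then offdiag i
    else if nat_of_ord i == j.+1 then offdiag j
    else 0.

Definition stieltjes {R : realType} (m : nat) (A : 'M[R]_m) (z : R[i]) : R[i] :=
  m%:R^-1 * \tr (invmx (map_mx (real_complex R) A - z%:M)).

(* Main.v *)
Require Import Defs.
From HB Require Import structures.
From mathcomp Require Import all_boot all_order all_algebra.
From mathcomp Require Import complex.
From mathcomp Require Import all_classical all_reals all_analysis.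
From mathcomp Require Import measurable_realfun lra ring.

Set Implicit Arguments.
Unset Strict Implicit.
Unset Printing Implicit Defensive.

Import Order.TTheory GRing.Theory Num.Theory.

Local Open Scope classical_set_scope.
Local Open Scope ring_scope.
Local Open Scope complex_scope.

(* Write eta = Im z. The resolvent identity gives
     s_beta - s_infty = (1/m) tr (G (M_infty - M_beta) G_infty),
   and since the rows and columns of a resolvent have Euclidean norm at most
   1/eta, its modulus is at most (1/m) eta^-2 times the sum of the absolute
   values of the entries of M_infty - M_beta. The matrix M_infty is
   (d / (beta m)) b b^T, where b is B_beta with each chi_r entry replaced by
   sqrt r; so if every entry of B_beta is within tau = O(m^(eps/2)) of the
   corresponding entry of b, that sum is O(m^(1/2) tau + tau^2), and
   eta^-2 < m^(1/2 - 2 eps) concludes. The entries concentrate at Gaussian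
   rate: translating the chi density by t away from its mode multiplies it by
   at most exp(- t^2 / 2). A union bound over the entries finishes the proof. *)

(** * Translation estimates for the chi density *)

Lemma powR_le_expR {R : realType} (u p : R) :
  0 < u -> 0 <= p -> u `^ p <= expR (p * (u - 1)).
Proof.
move=> u0 p0; rewrite /powR gt_eqF// ler_expR ler_wpM2l// lerBrDl.
by rewrite -{2}(lnK u0); exact: expR_ge1Dx.
Qed.

(** The ratio of the two weights is [((x + t) / x) ^ (r - 1)] times [exp (- x t - t^2 / 2)]. Raising
    the exponent to [a^2] bounds the power by [exp (a^2 t / x) <= exp (x t)], which cancels the
    cross term. *)
Lemma chi_weight_shiftr {R : realType} (r a t x : R) :
  0 <= a -> r - 1 <= a ^+ 2 -> 0 <= t -> a < x ->
  (x + t) `^ (r - 1) * expR (- ((x + t) ^+ 2 / 2)) <=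
  expR (- (t ^+ 2 / 2)) * (x `^ (r - 1) * expR (- (x ^+ 2 / 2))).
Proof.
move=> a0 ra t0 ax; have x0 : 0 < x by exact: le_lt_trans ax.
have u1 : 1 <= (x + t) / x by rewrite ler_pdivlMr// mul1r lerDl.
have -> : x + t = x * ((x + t) / x) by field; rewrite gt_eqF.
rewrite powRM ?(ltW x0)//; last exact: le_trans u1.
have -> : x * ((x + t) / x) = x + t by field; rewrite gt_eqF.
rewrite -[leLHS]mulrA [leRHS]mulrCA ler_wpM2l ?powR_ge0//.
apply: (@le_trans _ _ (expR (x * t) * expR (- ((x + t) ^+ 2 / 2)))).
  apply: ler_wpM2r; first exact: expR_ge0.
  apply: (le_trans (ler_powR u1 ra)).
  apply: le_trans (powR_le_expR _ _) _; [lra|exact: sqr_ge0|].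
  rewrite ler_expR; have -> : (x + t) / x - 1 = t / x by field; rewrite gt_eqF.
  rewrite mulrA ler_pdivrMr// [leRHS]mulrAC -expr2 ler_wpM2r//.
  by rewrite ler_sqr ?nnegrE ?(ltW ax) ?(ltW x0).
by rewrite -!expRD ler_expR; lra.
Qed.

(** Mirror image: [(x / (x + t)) ^ (r - 1)] is at most [exp (- (r - 1) t / (x + t))], hence at most
    [exp (- (x + t) t)], because [(x + t)^2 <= a^2 <= r - 1]. *)
Lemma chi_weight_shiftl {R : realType} (r a t x : R) :
  a ^+ 2 <= r - 1 -> 0 <= t -> 0 < x -> x + t <= a ->
  x `^ (r - 1) * expR (- (x ^+ 2 / 2)) <=
  expR (- (t ^+ 2 / 2)) * ((x + t) `^ (r - 1) * expR (- ((x + t) ^+ 2 / 2))).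
Proof.
move=> ar t0 x0 xta; have xt0 : 0 < x + t by lra.
have r1 : 0 <= r - 1 by apply: le_trans ar; exact: sqr_ge0.
have u0 : 0 < x / (x + t) by rewrite divr_gt0.
have {1}-> : x = (x + t) * (x / (x + t)) by field; rewrite gt_eqF.
rewrite powRM ?(ltW xt0) ?(ltW u0)//.
rewrite -[leLHS]mulrA [leRHS]mulrCA ler_wpM2l ?powR_ge0//.
apply: (@le_trans _ _ (expR (- ((x + t) * t)) * expR (- (x ^+ 2 / 2)))).
  apply: ler_wpM2r; first exact: expR_ge0.
  apply: le_trans (powR_le_expR _ _) _ => //.
  rewrite ler_expR.
  have -> : x / (x + t) - 1 = - (t / (x + t)) by field; rewrite gt_eqF.
  rewrite mulrN lerN2 mulrA ler_pdivlMr// mulrAC -expr2 ler_wpM2r//.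
  by apply: le_trans ar; rewrite ler_sqr ?nnegrE; lra.
by rewrite -!expRD ler_expR; lra.
Qed.

Lemma chi_pdf_ge0 {R : realType} (r x : R) : 0 <= chi_pdf r x.
Proof.
rewrite /chi_pdf; case: ifPn => // x0.
rewrite !mulr_ge0 ?powR_ge0 ?expR_ge0// invr_ge0 /Gamma_fun.
apply: fine_ge0; apply: integral_ge0 => t _.
by rewrite lee_fin mulr_ge0 ?powR_ge0 ?expR_ge0.
Qed.

Lemma measurable_chi_pdf {R : realType} (r : R) : measurable_fun setT (chi_pdf r).
Proof.
apply: measurable_fun_ifT.
- exact: measurable_fun_ltr.
- apply: measurable_funM; last first.
    by do 2 apply: measurableT_comp => //; apply: measurable_funM => //;
      exact: measurable_funX.
  by apply: measurable_funM => //; exact: measurable_powR.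
- exact: measurable_cst.
Qed.

Lemma chi_pdf_shiftr {R : realType} (r a t x : R) :
  0 <= a -> r - 1 <= a ^+ 2 -> 0 <= t -> a < x ->
  chi_pdf r (x + t) <= expR (- (t ^+ 2 / 2)) * chi_pdf r x.
Proof.
move=> a0 ra t0 ax; have x0 : 0 < x by exact: le_lt_trans ax.
(* Evaluating the density at 1 shows that its normalizing constant is nonnegative. *)
have := chi_pdf_ge0 r 1; rewrite /chi_pdf ltr01 x0 ltr_pwDl//.
rewrite powR1 mulr1 pmulr_lge0 ?expR_gt0// => c0.
rewrite -[leLHS]mulrA -[X in _ <= _ * X]mulrA [leRHS]mulrCA ler_wpM2l//.
exact: chi_weight_shiftr a0 ra t0 ax.
Qed.

Lemma chi_pdf_shiftl {R : realType} (r a t x : R) :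
  a ^+ 2 <= r - 1 -> 0 <= t -> x + t <= a ->
  chi_pdf r x <= expR (- (t ^+ 2 / 2)) * chi_pdf r (x + t).
Proof.
move=> ar t0 xta; have [x0|x0] := ltP 0 x; last first.
  by rewrite {1}/chi_pdf ltNge x0/= mulr_ge0 ?expR_ge0 ?chi_pdf_ge0.
have := chi_pdf_ge0 r 1; rewrite /chi_pdf ltr01 x0 ltr_pwDl//.
rewrite powR1 mulr1 pmulr_lge0 ?expR_gt0// => c0.
rewrite -[leLHS]mulrA -[X in _ <= _ * X]mulrA [leRHS]mulrCA ler_wpM2l//.
exact: chi_weight_shiftl ar _ _ _.
Qed.

(** Translation invariance: the pushforward of Lebesgue measure by [x + t] gives each half-open
    interval its length, and these values determine the measure. *)
Lemma ge0_integral_shift {R : realType} (t : R) (D : set R) (f : R -> \bar R) :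
  measurable D -> measurable_fun setT f -> (forall x, 0 <= f x)%E ->
  (\int[lebesgue_measure]_(y in D) f y =
   \int[lebesgue_measure]_(x in (fun x => x + t)%R @^-1` D) f (x + t)%R)%E.
Proof.
move=> mD mf f0.
pose phi (x : R) : measurableTypeR R := x + t.
have mphi : measurable_fun setT phi by exact: measurable_funD.
transitivity (\int[pushforward lebesgue_measure phi]_(y in D) f y)%E; last first.
  by rewrite ge0_integral_pushforward//; exact: measurable_funS mf.
apply: eq_measure_integral => A mA _.
apply: lebesgue_measure_unique => //= _ [[u v]] _ <-.
rewrite /pushforward/=.
have -> : phi @^-1` `]u, v]%classic = `]u - t, v - t]%classic.
  by apply/seteqP; split => x /=; rewrite /phi !in_itv/= ltrBlDr lerBrDr.
rewrite !lebesgue_measure_itv/= !lte_fin ltrBlDr subrK.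
by case: ifPn => // _; congr (_%:E); ring.
Qed.

(** * Gaussian tails of a chi variable *)

Section chi_tail.
Context {R : realType} {disp : measure_display} {T : measurableType disp}.
Context {P : probability T R} (X : {RV P >-> R}) (r : R).
Hypothesis Xr : chi_distributed X r.

(** The integral is a probability, the density being that of the law of [X]; this controls its mass
    without computing a Gamma integral. *)
Let int_le1 (A : set R) : measurable A ->
  (\int[lebesgue_measure]_(x in A) (chi_pdf r x)%:E <= 1)%E.
Proof. by move=> mA; rewrite -Xr//; exact: probability_le1. Qed.

Let mpdf : measurable_fun setT (fun x => (chi_pdf r x)%:E).
Proof. by apply/measurable_EFinP; exact: measurable_chi_pdf. Qed.

Let pdf0 x : (0 <= (chi_pdf r x)%:E)%E.
Proof. by rewrite lee_fin chi_pdf_ge0. Qed.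

Let mshift t : measurable_fun setT (fun x : R => (chi_pdf r (x + t))%:E).
Proof.
apply/measurable_EFinP; apply: measurableT_comp; first exact: measurable_chi_pdf.
exact: measurable_funD.
Qed.

(** Translation by [t] carries the half-line beyond [a] onto the one beyond [a + t]. The density
    loses the factor [exp (- t^2 / 2)] pointwise, and the mass left is at most 1. *)
Lemma chi_right_tail (a t : R) : 0 <= a -> r - 1 <= a ^+ 2 -> 0 <= t ->
  (P (X @^-1` `](a + t)%R, +oo[) <= (expR (- (t ^+ 2 / 2))%R)%:E)%E.
Proof.
move=> a0 ra t0; rewrite -[P _]/(distribution P X _) Xr//.
rewrite (ge0_integral_shift t)//.
have -> : (fun x => x + t) @^-1` `]a + t, +oo[%classic = `]a, +oo[%classic.
  by apply/seteqP; split => x /=; rewrite !in_itv/= !andbT ltrD2r.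
apply: (@le_trans _ _ (\int[lebesgue_measure]_(x in `]a, +oo[)
    ((expR (- (t ^+ 2 / 2))%R)%:E * (chi_pdf r x)%:E))%E).
  apply: ge0_le_integral => //=.
  - exact: measurable_funS (mshift t).
  - by apply: emeasurable_funM => //; exact: measurable_funS mpdf.
  - move=> x; rewrite in_itv/= andbT => ax.
    by rewrite -EFinM lee_fin; exact: chi_pdf_shiftr a0 ra t0 ax.
rewrite ge0_integralZl//; last exact: measurable_funS mpdf.
by rewrite -[leRHS]mule1 lee_wpmul2l ?lee_fin ?expR_ge0 ?int_le1.
Qed.

Lemma chi_left_tail (a t : R) : a ^+ 2 <= r - 1 -> 0 <= t ->
  (P (X @^-1` `]-oo, (a - t)%R[) <= (expR (- (t ^+ 2 / 2))%R)%:E)%E.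
Proof.
move=> ar t0; rewrite -[P _]/(distribution P X _) Xr//.
apply: (@le_trans _ _ (\int[lebesgue_measure]_(x in `]-oo, (a - t)%R[)
    ((expR (- (t ^+ 2 / 2))%R)%:E * (chi_pdf r (x + t))%:E))%E).
  apply: ge0_le_integral => //=.
  - exact: measurable_funS mpdf.
  - by apply: emeasurable_funM => //; exact: measurable_funS (mshift t).
  - move=> x; rewrite in_itv/= => xa.
    rewrite -EFinM lee_fin; apply: chi_pdf_shiftl ar t0 _; lra.
rewrite ge0_integralZl//; last exact: measurable_funS (mshift t).
have -> : `]-oo, a - t[%classic = (fun x => x + t) @^-1` `]-oo, a[%classic.
  by apply/seteqP; split => x /=; rewrite !in_itv/= ltrBrDr.
rewrite -(@ge0_integral_shift _ t _ (fun x => (chi_pdf r x)%:E))//.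
by rewrite -[leRHS]mule1 lee_wpmul2l ?lee_fin ?expR_ge0 ?int_le1.
Qed.

Lemma chi_left_support (a : R) : a <= 0 -> P (X @^-1` `]-oo, a[) = 0.
Proof.
move=> a0; rewrite -[P _]/(distribution P X _) Xr//.
apply: integral0_eq => x /=; rewrite in_itv/= => xa.
by rewrite /chi_pdf ifN// -leNgt ltW// (lt_le_trans xa).
Qed.

Lemma chi_concentration (t : R) : 0 <= r -> 0 <= t ->
  (P [set w | 1 + t < `|X w - Num.sqrt r|]%R <=
     (2 * expR (- (t ^+ 2 / 2))%R)%:E)%E.
Proof.
move=> r0 t0.
(* For r >= 1 this is the mode of the chi density; it is within 1 of sqrt r. *)
pose a := Num.sqrt (Num.max (r - 1) 0).
have a2 : a ^+ 2 = Num.max (r - 1) 0 by rewrite sqr_sqrtr// le_max lexx orbT.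
have a0 : 0 <= a by exact: sqrtr_ge0.
have s2 := sqr_sqrtr r0; have s0 := sqrtr_ge0 r.
have sa : a <= Num.sqrt r by rewrite ler_wsqrtr// ge_max r0 andbT; lra.
(* Compare squares: [(a + 1)^2 >= a^2 + 1 >= r]. *)
have as1 : Num.sqrt r <= a + 1.
  rewrite -ler_sqr ?nnegrE//; last by lra.
  rewrite s2 sqrrD a2 mulr1 expr1n.
  have : r - 1 <= Num.max (r - 1) 0 by rewrite le_max lexx.
  lra.
pose A := X @^-1` `]a + t, +oo[; pose B := X @^-1` `]-oo, a - t[.
have mA : measurable A by exact: measurable_sfunP.
have mB : measurable B by exact: measurable_sfunP.
apply: (@le_trans _ _ (P (A `|` B))).
  apply: le_measure; rewrite ?inE.
  - rewrite (_ : [set w | _] = X @^-1` [set x | 1 + t < `|x - Num.sqrt r|])//.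
    apply: measurable_sfunP; rewrite -[X in measurable X]setTI.
    apply: measurable_fun_ltr => //.
    by apply: measurableT_comp => //; exact: measurable_funD.
  - exact: measurableU.
  (* The 1 in the threshold absorbs the gap between [a] and [sqrt r]. *)
  - move=> w /=; rewrite /A /B /= !in_itv/= andbT ltr_normr => /orP[|] ?; [left|right]; lra.
apply: (le_trans (measureU2 _ _ _)) => //.
have -> : (2 * expR (- (t ^+ 2 / 2)))%:E =
  ((expR (- (t ^+ 2 / 2))%R)%:E + (expR (- (t ^+ 2 / 2))%R)%:E)%E.
  by rewrite -EFinD; congr (_%:E); ring.
apply: leeD.
  by apply: chi_right_tail => //; rewrite a2 le_max lexx.
have [r1|r1] := leP 0 (r - 1).
  by apply: chi_left_tail => //; rewrite a2 max_l.
(* For [r < 1] the point [a] is 0, and the lower tail lies where the density vanishes. *)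
have /le_trans : (P B <= 0)%E; last by apply; rewrite lee_fin expR_ge0.
rewrite /B chi_left_support//.
by rewrite /a max_r ?sqrtr0 ?(ltW r1)//; lra.
Qed.

End chi_tail.

(** * Measurability of complex-valued functions and of traces of inverses *)

Section measurable_complex.
Context {R : realType} {disp : measure_display} {T : measurableType disp}.

Definition measurable_complex (f : T -> R[i]) :=
  measurable_fun setT (fun w => complex.Re (f w)) /\
  measurable_fun setT (fun w => complex.Im (f w)).

Lemma measurable_complex_cst (c : R[i]) : measurable_complex (fun=> c).
Proof. by split; exact: measurable_cst. Qed.

Lemma measurable_complex_real (f : T -> R) :
  measurable_fun setT f -> measurable_complex (fun w => (f w)%:C).
Proof. by split => //=; exact: measurable_cst. Qed.

Lemma measurable_complexD (f g : T -> R[i]) : measurable_complex f ->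
  measurable_complex g -> measurable_complex (fun w => f w + g w).
Proof.
move=> [fr fi] [gr gi]; split.
  rewrite (_ : (fun w => _) = (fun w => complex.Re (f w) + complex.Re (g w))).
    exact: measurable_funD.
  by apply/funext => w; case: (f w) (g w) => ? ? [].
rewrite (_ : (fun w => _) = (fun w => complex.Im (f w) + complex.Im (g w))).
  exact: measurable_funD.
by apply/funext => w; case: (f w) (g w) => ? ? [].
Qed.

Lemma measurable_complexM (f g : T -> R[i]) : measurable_complex f ->
  measurable_complex g -> measurable_complex (fun w => f w * g w).
Proof.
move=> [fr fi] [gr gi]; split.
  rewrite (_ : (fun w => _) = (fun w => complex.Re (f w) * complex.Re (g w) -
      complex.Im (f w) * complex.Im (g w))).
    by apply: measurable_funB; exact: measurable_funM.
  by apply/funext => w; case: (f w) (g w) => ? ? [].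
rewrite (_ : (fun w => _) = (fun w => complex.Re (f w) * complex.Im (g w) +
    complex.Im (f w) * complex.Re (g w))).
  by apply: measurable_funD; exact: measurable_funM.
by apply/funext => w; case: (f w) (g w) => ? ? [].
Qed.

Lemma measurable_complexB (f g : T -> R[i]) : measurable_complex f ->
  measurable_complex g -> measurable_complex (fun w => f w - g w).
Proof.
move=> mf mg; rewrite (_ : (fun w => _) = fun w => f w + (-1) * g w).
  by apply: measurable_complexD => //; apply: measurable_complexM => //;
    exact: measurable_complex_cst.
by apply/funext => w; rewrite mulN1r.
Qed.

Lemma measurable_complex_sum (I : Type) (s : seq I) (p : pred I) (F : I -> T -> R[i]) :
  (forall i, measurable_complex (F i)) ->
  measurable_complex (fun w => \sum_(i <- s | p i) F i w).
Proof.
move=> mF; elim: s => [|a s ih].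
  under eq_fun do rewrite big_nil; exact: measurable_complex_cst.
under eq_fun do rewrite big_cons; case: (p a) => //.
exact: measurable_complexD.
Qed.

Lemma measurable_complex_prod (I : Type) (s : seq I) (p : pred I) (F : I -> T -> R[i]) :
  (forall i, measurable_complex (F i)) ->
  measurable_complex (fun w => \prod_(i <- s | p i) F i w).
Proof.
move=> mF; elim: s => [|a s ih].
  under eq_fun do rewrite big_nil; exact: measurable_complex_cst.
under eq_fun do rewrite big_cons; case: (p a) => //.
exact: measurable_complexM.
Qed.

Let measurable_sqnorm (f : T -> R[i]) : measurable_complex f ->
  measurable_fun setT (fun w => complex.Re (f w) ^+ 2 + complex.Im (f w) ^+ 2).
Proof.
by move=> [fr fi]; apply: measurable_funD; exact: measurable_funX.
Qed.

Lemma measurable_complexV (f : T -> R[i]) : measurable_complex f ->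
  measurable_complex (fun w => (f w)^-1).
Proof.
move=> mf; have [fr fi] := mf.
have mV : measurable_fun setT
    (fun w => (complex.Re (f w) ^+ 2 + complex.Im (f w) ^+ 2)^-1).
  (* The inverse is the real power of exponent -1, also at 0, where both are 0. *)
  under eq_fun do rewrite -powR_inv1 ?addr_ge0 ?sqr_ge0//.
  apply: (measurableT_comp (measurable_powR (-1))).
  exact: measurable_sqnorm.
split.
  rewrite (_ : (fun w => _) = (fun w => complex.Re (f w) *
      (complex.Re (f w) ^+ 2 + complex.Im (f w) ^+ 2)^-1)).
    exact: measurable_funM.
  by apply/funext => w; case: (f w).
rewrite (_ : (fun w => _) = (fun w => - (complex.Im (f w) *
    (complex.Re (f w) ^+ 2 + complex.Im (f w) ^+ 2)^-1))).
  by apply: measurable_funN; exact: measurable_funM.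
by apply/funext => w; case: (f w).
Qed.

Lemma measurable_complex_det n (M : T -> 'M[R[i]]_n) :
  (forall i j, measurable_complex (fun w => M w i j)) ->
  measurable_complex (fun w => \det (M w)).
Proof.
move=> mM; rewrite /determinant; apply: measurable_complex_sum => s.
apply: measurable_complexM; first exact: measurable_complex_cst.
exact: measurable_complex_prod.
Qed.

(** By Cramer's rule the trace is a quotient of polynomials in the entries. Invertibility at every
    [w] matters, since [invmx] returns a singular matrix unchanged. *)
Lemma measurable_complex_tr_invmx n (M : T -> 'M[R[i]]_n) :
  (forall w, M w \in unitmx) ->
  (forall i j, measurable_complex (fun w => M w i j)) ->
  measurable_complex (fun w => \tr (invmx (M w))).
Proof.
move=> uM mM.
rewrite (_ : (fun w => _) = fun w => (\det (M w))^-1 * \tr (\adj (M w))).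
  apply: measurable_complexM.
    by apply: measurable_complexV; exact: measurable_complex_det.
  apply: measurable_complex_sum => i; under eq_fun do rewrite mxE /cofactor.
  apply: measurable_complexM; first exact: measurable_complex_cst.
  by apply: measurable_complex_det => j k; under eq_fun do rewrite !mxE.
by apply/funext => w; rewrite /invmx uM mxtraceZ.
Qed.

Lemma measurable_normc_gt (f : T -> R[i]) (c : R) : measurable_complex f ->
  measurable [set w | c%:C < `|f w|].
Proof.
move=> mf; under eq_set do rewrite normc_def ltcR.
rewrite -[X in measurable X]setTI; apply: measurable_fun_ltr => //.
under eq_fun do rewrite -powR12_sqrt ?addr_ge0 ?sqr_ge0//.
apply: (measurableT_comp (measurable_powR _)); exact: measurable_sqnorm.
Qed.

End measurable_complex.

(** * Resolvent bounds for real symmetric matrices *)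

Lemma real_complex_sum {R : realType} (I : finType) (F : I -> R) :
  \sum_i (F i)%:C = (\sum_i F i)%:C.
Proof. by rewrite rmorph_sum. Qed.

Section resolvent.
Context {R : realType} (n : nat) (z : R[i]).
Hypothesis z_gt0 : 0 < complex.Im z.

Let shifted (A : 'M[R]_n) : 'M[R[i]]_n := map_mx (real_complex R) A - z%:M.
Let sqn (x : R[i]) : R := complex.Re x ^+ 2 + complex.Im x ^+ 2.

Let sqn_ge0 x : 0 <= sqn x. Proof. by rewrite addr_ge0 ?sqr_ge0. Qed.

(** The form [u A u^*] equals its conjugate because [A] is real symmetric, so only the term
    [- z |u|^2] has an imaginary part. *)
Lemma Im_quadratic_form (A : 'M[R]_n) (u : 'rV[R[i]]_n) : A^T = A ->
  complex.Im (\sum_j (u *m shifted A) 0 j * (u 0 j)^*) =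
  - (complex.Im z * \sum_j sqn (u 0 j)).
Proof.
move=> As; pose S := \sum_j (\sum_k u 0 k * (A k j)%:C) * (u 0 j)^*.
have S_real : S^* = S.
  rewrite /S rmorph_sum/=.
  under eq_bigr do rewrite rmorphM rmorph_sum/= conjcK mulr_suml.
  rewrite exchange_big/=; apply: eq_bigr => j _.
  rewrite mulr_suml; apply: eq_bigr => k _.
  by rewrite rmorphM/= oppr0 -[_ +i* 0]/((A j k)%:C) -{1}As mxE; ring.
have -> : \sum_j (u *m shifted A) 0 j * (u 0 j)^* =
    S - z * (\sum_j sqn (u 0 j))%:C.
  rewrite /S -real_complex_sum mulr_sumr -sumrB; apply: eq_bigr => j _.
  rewrite mulmxBr mul_mx_scalar !mxE mulrBl; congr (_ * _ - _).
    by apply: eq_bigr => k _; rewrite mxE.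
  rewrite -mulrA; congr (_ * _); rewrite /sqn.
  by case: (u 0 j) => a b; apply/eqP; rewrite eq_complex/=; apply/andP; split; apply/eqP; ring.
have : complex.Im S = 0.
  by case: S S_real => a b [] /=; lra.
case: S S_real z => a b _ [c d] /= ->; ring.
Qed.

(** On a kernel vector the quadratic form is 0, so [Im z |u|^2 = 0] and the vector vanishes. *)
Lemma shifted_unitmx (A : 'M[R]_n) : A^T = A -> shifted A \in unitmx.
Proof.
move=> As; rewrite -row_free_unit; apply/row_freeP.
suff /row_freeP : row_free (shifted A) by [].
rewrite -kermx_eq0; apply/rowV0P => u /sub_kermxP uA.
have := Im_quadratic_form u As; rewrite uA big1 => [/= |j _]; last by rewrite mxE mul0r.
move/eqP; rewrite eq_sym oppr_eq0 mulf_eq0 gt_eqF//= psumr_eq0// => /allP s0.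
apply/rowP => j; have := s0 j (mem_index_enum _); rewrite /sqn paddr_eq0 ?sqr_ge0//.
rewrite !sqrf_eq0 mxE => /andP[/eqP a0 /eqP b0].
by case: (u 0 j) a0 b0 => a b /= -> ->.
Qed.

(** For [u] the row [i] of the resolvent [G], the quadratic form is the conjugate of [G i i]. With
    [s] the squared norm of the row, this is the Ward identity [Im z s = Im (G i i)]; as
    [|G i i|^2 <= s], squaring gives [(Im z)^2 s^2 <= s]. *)
Lemma resolvent_row_le (A : 'M[R]_n) (i : 'I_n) : A^T = A ->
  \sum_j sqn (invmx (shifted A) i j) <= (complex.Im z ^+ 2)^-1.
Proof.
move=> As; pose u := row i (invmx (shifted A)).
have uE : u *m shifted A = delta_mx 0 i.
  by rewrite -row_mul mulVmx ?shifted_unitmx// rowE mulmx1.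
have := Im_quadratic_form u As; rewrite uE (bigD1 i)//= big1 ?addr0; last first.
  by move=> j ji; rewrite mxE (negbTE ji) andbF mul0r.
rewrite mxE !eqxx mul1r; under eq_bigr do rewrite mxE.
rewrite [in X in X -> _]mxE => /eqP.
set G := invmx _; set s := \sum_j _ => h.
have : sqn (G i i) <= s by rewrite /s (bigD1 i)//= lerDl sumr_ge0.
have s0 : 0 <= s by rewrite sumr_ge0.
have h' : complex.Im z * s = complex.Im (G i i).
  by move: h; case: (G i i) => a b /=; rewrite eqr_opp => /eqP.
rewrite /sqn => le_s.
have : (complex.Im z * s) ^+ 2 <= s.
  by rewrite h'; apply: le_trans le_s; rewrite lerDr sqr_ge0.
have [->|sn0] := eqVneq s 0; first by rewrite invr_ge0 sqr_ge0.
have sp : 0 < s by rewrite lt_neqAle eq_sym sn0.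
move=> h2; rewrite -[leRHS]mul1r ler_pdivlMr ?exprn_gt0// mulrC -(ler_pM2r sp) mul1r.
by apply: le_trans h2; rewrite exprMn [s ^+ 2]expr2 mulrA.
Qed.

Lemma resolvent_sym (A : 'M[R]_n) : A^T = A ->
  (invmx (shifted A))^T = invmx (shifted A).
Proof.
by move=> As; rewrite trmx_inv /shifted linearB/= tr_scalar_mx map_trmx As.
Qed.

Lemma stieltjes_diff_le (A B : 'M[R]_n) : A^T = A -> B^T = B ->
  `|stieltjes A z - stieltjes B z| <=
  (n%:R^-1 * (complex.Im z ^+ 2)^-1 * \sum_i \sum_j `|A i j - B i j|)%:C.
Proof.
move=> As Bs; rewrite /stieltjes -/(shifted A) -/(shifted B).
set G := invmx (shifted A); set H := invmx (shifted B).
pose D := map_mx (real_complex R) (B - A).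
have GH : G - H = G *m D *m H.
  have -> : D = shifted B - shifted A.
    by rewrite /shifted opprB addrA subrK /D map_mxB.
  rewrite mulmxBr mulmxBl -mulmxA mulmxV ?shifted_unitmx// mulmx1.
  by rewrite mulVmx ?shifted_unitmx// mul1mx.
rewrite -mulrBr -linearB/= GH normrM normfV normr_nat.
rewrite -mulrA rmorphM/= fmorphV rmorph_nat ler_wpM2l ?invr_ge0 ?ler0n//.
pose nrm (x : R[i]) := Num.sqrt (sqn x).
have nrmE x : `|x| = (nrm x)%:C by rewrite normc_def.
have nrm2 x : nrm x ^+ 2 = sqn x by rewrite sqr_sqrtr.
apply: (@le_trans _ _ (\sum_i \sum_k \sum_j nrm (G i j) * `|A j k - B j k| * nrm (H k i))%:C).
  rewrite rmorph_sum/=; apply: le_trans (ler_norm_sum _ _ _) _; apply: ler_sum => i _.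
  rewrite mxE rmorph_sum/=; apply: le_trans (ler_norm_sum _ _ _) _; apply: ler_sum => k _.
  rewrite normrM mxE rmorph_sum/=.
  under [leRHS]eq_bigr do rewrite rmorphM/= -nrmE.
  rewrite -mulr_suml ler_wpM2r//; apply: le_trans (ler_norm_sum _ _ _) _.
  apply: ler_sum => j _; rewrite normrM rmorphM/= -nrmE !mxE ler_wpM2l//.
  by rewrite normc_def /= expr0n addr0 sqrtr_sqr distrC.
(* The sum over [i] is moved inside: each entry of [A - B] is then weighted by the product of a
   column of [G] and a row of [H]. *)
rewrite lecR exchange_big/=; under eq_bigr do rewrite exchange_big/=.
rewrite exchange_big/= mulr_sumr; apply: ler_sum => j _.
rewrite mulr_sumr; apply: ler_sum => k _.
under eq_bigr do rewrite mulrAC.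
rewrite -mulr_suml ler_wpM2r//.
(* AM-GM replaces Cauchy-Schwarz: both factors have the same bound. *)
apply: (@le_trans _ _ (\sum_i 2^-1 * (sqn (G i j) + sqn (H k i)))).
  apply: ler_sum => i _; rewrite -!nrm2.
  by have := sqr_ge0 (nrm (G i j) - nrm (H k i)); rewrite sqrrB; lra.
rewrite -mulr_sumr big_split/=.
have gj := resolvent_row_le j As; have hk := resolvent_row_le k Bs.
(* By symmetry of the resolvent, the column [j] is also a row. *)
have : \sum_i sqn (G i j) <= (complex.Im z ^+ 2)^-1.
  rewrite /G -(resolvent_sym As); under eq_bigr do rewrite mxE; exact: gj.
rewrite -/H in hk; lra.
Qed.

End resolvent.

(** * Gram matrices of nearby bidiagonal matrices *)

Section bidiagonal_perturbation.
Context {R : realType} (m : nat) (X Y : 'M[R]_m) (tau S : R).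
Hypotheses (tau_ge0 : 0 <= tau) (S_ge0 : 0 <= S).
Hypothesis X_supp : forall i j, (i, j) \notin bidiag_support m -> X i j = 0.
Hypothesis Y_supp : forall i j, (i, j) \notin bidiag_support m -> Y i j = 0.
Hypothesis XY : forall i j, `|X i j - Y i j| <= tau.
Hypothesis Y_le : forall i j, `|Y i j| <= S.

Let supp (i k : 'I_m) : R := ((i, k) \in bidiag_support m)%:R.

Let supp_col_le (k : 'I_m) : \sum_i supp i k <= 2.
Proof.
apply: (@le_trans _ _ (\sum_i ((i == k)%:R + (nat_of_ord i == k.+1)%:R))).
  apply: ler_sum => i _; rewrite /supp inE/= -natrD ler_nat.
  by case: (i == k); case: (_ == _).
rewrite big_split/= (bigD1 k)//= eqxx big1 ?addr0; last by move=> i /negbTE ->.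
rewrite -[2]/(1 + 1) lerD2l.
(* The last column has no subdiagonal entry. *)
have [km|km] := ltnP k.+1 m; last first.
  rewrite big1// => i _; rewrite ltn_eqF//; exact: leq_trans (ltn_ord i) km.
rewrite (bigD1 (Ordinal km))//= eqxx big1 ?addr0// => i ik.
by rewrite (_ : (_ == _) = false)//; apply: contra_neqF ik => /eqP ik; exact: val_inj.
Qed.

Let prod_le (i j k : 'I_m) : `|X i k * X j k - Y i k * Y j k| <=
  supp i k * supp j k * (2 * tau * S + tau ^+ 2).
Proof.
rewrite /supp; case: (boolP ((i, k) \in _)) => ik; last first.
  by rewrite (X_supp ik) (Y_supp ik) !mul0r subrr normr0.
case: (boolP ((j, k) \in _)) => jk; last first.
  by rewrite (X_supp jk) (Y_supp jk) !mulr0 mul0r subrr normr0.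
rewrite !mul1r.
have -> : X i k * X j k - Y i k * Y j k =
  (X i k - Y i k) * (X j k - Y j k) + (X i k - Y i k) * Y j k +
  Y i k * (X j k - Y j k) by ring.
apply: le_trans (ler_normD _ _) _; apply: le_trans (lerD (ler_normD _ _) (lexx _)) _.
rewrite !normrM.
have h1 : `|X i k - Y i k| * `|X j k - Y j k| <= tau * tau by rewrite ler_pM.
have h2 : `|X i k - Y i k| * `|Y j k| <= tau * S by rewrite ler_pM.
have h3 : `|Y i k| * `|X j k - Y j k| <= S * tau by rewrite ler_pM.
by lra.
Qed.

(** Each column [k] meets the support in at most two rows, so it contributes to at most four pairs
    [(i, j)]; the [m] columns give the factor [4 m]. *)
Lemma bidiagonal_gram_diff_le :
  \sum_i \sum_j `|(X *m X^T) i j - (Y *m Y^T) i j| <=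
  4 * m%:R * (2 * tau * S + tau ^+ 2).
Proof.
set K := 2 * tau * S + tau ^+ 2.
have K0 : 0 <= K by rewrite addr_ge0 ?sqr_ge0 ?mulr_ge0.
apply: (@le_trans _ _ (\sum_i \sum_j \sum_k supp i k * supp j k * K)).
  apply: ler_sum => i _; apply: ler_sum => j _; rewrite !mxE -sumrB.
  apply: le_trans (ler_norm_sum _ _ _) _; apply: ler_sum => k _.
  by rewrite !mxE; exact: prod_le.
under eq_bigr do rewrite exchange_big/=.
rewrite exchange_big/=.
apply: (@le_trans _ _ (\sum_(k < m) 4 * K)); last first.
  by rewrite sumr_const card_ord -mulr_natr; lra.
apply: ler_sum => k _.
under eq_bigr do rewrite -mulr_suml -mulr_sumr.
rewrite -!mulr_suml ler_wpM2r//.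
have := supp_col_le k; set s := \sum_i _ => s2.
have s0 : 0 <= s by rewrite sumr_ge0// => i _; rewrite /supp ler0n.
by apply: le_trans (ler_pM _ _ s2 s2) _ => //; lra.
Qed.

End bidiagonal_perturbation.

(** * The bidiagonal factor of the limit matrix *)

Section limit_bidiagonal.
Context {R : realType} (beta d : R) (m : nat).

(** The value 0 off the two diagonals makes the square root vanish there. Indices are natural
    numbers, so that a predecessor can be named without a bound. *)
Definition chi_param (i j : nat) : R :=
  if i == j then m%:R * beta / d - beta * j%:R
  else if i == j.+1 then beta * (m%:R - j.+1%:R) else 0.

Definition infty_bidiag : 'M[R]_m := \matrix_(i, j) Num.sqrt (chi_param i j).

Hypotheses (beta_gt0 : 0 < beta) (d_gt0 : 0 < d) (d_le1 : d <= 1).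

Lemma chi_param_ge0 (i j : 'I_m) : 0 <= chi_param i j.
Proof.
rewrite /chi_param; case: eqP => _.
  rewrite mulrAC mulrC -mulrBr mulr_ge0 ?(ltW beta_gt0)// subr_ge0.
  (* Since [d <= 1], the index is at most [m <= m / d]. *)
  apply: (@le_trans _ _ m%:R); first by rewrite ler_nat ltnW.
  by rewrite ler_pdivlMr// ler_piMr ?ler0n.
case: eqP => // ij; rewrite mulr_ge0 ?(ltW beta_gt0)// subr_ge0 ler_nat.
by rewrite -ij ltnW.
Qed.

Lemma chi_param_le (i j : 'I_m) : chi_param i j <= beta / d * m%:R.
Proof.
have bm : 0 <= beta * m%:R by rewrite mulr_ge0 ?(ltW beta_gt0) ?ler0n.
have bd : beta * m%:R <= beta / d * m%:R.
  by rewrite ler_wpM2r ?ler0n// ler_pdivlMr// ler_piMr ?(ltW beta_gt0).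
have bx n : 0 <= beta * n%:R :> R by rewrite mulr_ge0 ?(ltW beta_gt0) ?ler0n.
rewrite /chi_param; case: eqP => _.
  by rewrite (_ : m%:R * beta / d = beta / d * m%:R) ?gerBl//; ring.
case: eqP => _; last exact: le_trans bd.
by apply: le_trans bd; rewrite mulrBr gerBl.
Qed.

Lemma chi_param_supp (i j : 'I_m) :
  (i, j) \notin bidiag_support m -> chi_param i j = 0.
Proof.
by rewrite /chi_param inE/= negb_or => /andP[ij /negbTE ->]; rewrite ifN.
Qed.

(** Row [i] is supported on columns [i] and [i - 1], the latter absent for [i = 0]. Taking [F] to be
    another row yields the entries of the Gram matrix. *)
Lemma infty_bidiag_sum (i : 'I_m) (F : nat -> R) :
  \sum_(k < m) Num.sqrt (chi_param i k) * F k =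
  Num.sqrt (chi_param i i) * F i +
  (if nat_of_ord i is i'.+1 then Num.sqrt (chi_param i i') * F i' else 0).
Proof.
rewrite (bigD1 i)//=; congr (_ + _).
have [i0|i0] := posnP i.
  rewrite i0 big1// => k ki; rewrite /chi_param/= ifN ?sqrtr0 ?mul0r//.
  by apply: contra_neqN ki => /eqP k0; apply: val_inj; rewrite /= -k0.
have pm : (i.-1 < m)%N by apply: leq_ltn_trans (ltn_ord i); exact: leq_pred.
rewrite (bigD1 (Ordinal pm))/=; last by rewrite -val_eqE/= ltn_eqF// prednK.
rewrite big1 ?addr0; last first.
  move=> k /andP[ki ki']; rewrite /chi_param.
  have -> : (nat_of_ord i == k) = false.
    by apply: contra_neqF ki => /eqP ik; exact: val_inj.
  have -> : (nat_of_ord i == k.+1) = false.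
    by apply: contra_neqF ki' => /eqP ik; apply: val_inj; rewrite /= ik.
  by rewrite sqrtr0 mul0r.
by case: (nat_of_ord i) i0.
Qed.

Lemma laguerre_infty_bidiag :
  laguerre_mx beta d infty_bidiag = laguerre_infty_mx d m.
Proof.
have bd (n : nat) : m%:R * beta / d - beta * n%:R = beta * (m%:R / d - n%:R) :> R.
  by ring.
have sq (p q : R) : Num.sqrt (beta * p) * Num.sqrt (beta * q) =
    beta * (Num.sqrt p * Num.sqrt q).
  by rewrite !sqrtrM ?(ltW beta_gt0)// mulrACA -expr2 sqr_sqrtr ?(ltW beta_gt0).
apply/matrixP => i j; have m_gt0 : (0 < m)%N by exact: leq_ltn_trans (ltn_ord i).
have mR : m%:R != 0 :> R by rewrite pnatr_eq0 -lt0n.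
have bn : beta != 0 by rewrite gt_eqF.
have dn : d != 0 by rewrite gt_eqF.
rewrite !mxE.
under eq_bigr do rewrite !mxE.
rewrite (infty_bidiag_sum i (fun k => Num.sqrt (chi_param j k))).
case: (eqVneq i j) => [<-|ij].
  rewrite -expr2 sqr_sqrtr ?chi_param_ge0//.
  (* Row 0 has a single square, whence the exceptional corner entry 1; in the other rows two
     parameters add up to [beta (m / d + m - 2 i)]. *)
  case ei : (nat_of_ord i) => [|i'] /=.
    by rewrite /chi_param/= addr0 mulr0 subr0; field; rewrite bn dn mR.
  have i'm : (i' < m)%N by rewrite ltnW// -ei.
  have := chi_param_ge0 i (Ordinal i'm); rewrite /= ei => c0.
  rewrite -expr2 sqr_sqrtr// /chi_param eqxx gtn_eqF//.
  by field; rewrite bn dn mR.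
have ijn : (nat_of_ord i == j) = false.
  by apply: contra_neqF ij => /eqP; exact: val_inj.
(* Adjacent rows share exactly one column, the smaller of the two indices. *)
have [ji|ji] := eqVneq (nat_of_ord j) i.+1.
  rewrite /chi_param ji eqxx [(_.+1 == _ :> nat)]gtn_eqF// eqxx.
  rewrite bd sq.
  case: (nat_of_ord i) => [|i'].
    by rewrite addr0; field; rewrite bn mR.
  rewrite [(i'.+2 == i')]gtn_eqF// [(i'.+2 == i'.+1)]gtn_eqF// sqrtr0 mulr0 addr0.
  by field; rewrite bn mR.
have [ij1|ij1] := eqVneq (nat_of_ord i) j.+1.
  rewrite /chi_param ij1 eqxx [(nat_of_ord j == _.+1)]ltn_eqF//.
  rewrite [(nat_of_ord j == _.+2)]ltn_eqF// sqrtr0 mulr0 add0r gtn_eqF// eqxx.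
  by rewrite mulrC [Num.sqrt (beta * _) * _]mulrC bd sq; field; rewrite bn mR.
rewrite {2}/chi_param eq_sym ijn (negbTE ji) sqrtr0 mulr0 add0r.
case: (nat_of_ord i) ijn ij1 => [|i'] ijn ij1; first by rewrite mulr0.
rewrite {2}/chi_param (eq_sym (nat_of_ord j) i'.+1) ijn.
by rewrite eqSS eq_sym in ij1; rewrite (negbTE ij1) sqrtr0 !mulr0.
Qed.

End limit_bidiagonal.

(** * Union bound, deterministic comparison and conclusion *)

Lemma laguerre_mx_sym {R : realType} (beta d : R) m (B : 'M[R]_m) :
  (laguerre_mx beta d B)^T = laguerre_mx beta d B.
Proof. by rewrite /laguerre_mx linearZ/= trmx_mul trmxK. Qed.

Lemma measure_exists_le {R : realType} {disp : measure_display}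
    {T : measurableType disp} (P : probability T R) (I : finType)
    (A : I -> set T) (c : R) :
  (forall i, measurable (A i)) -> (forall i, P (A i) <= c%:E)%E ->
  measurable [set w | exists i, A i w] /\
  (P [set w | exists i, A i w] <= (#|I|%:R * c)%:E)%E.
Proof.
move=> mA Ac.
have -> : [set w | exists i, A i w] = \big[setU/set0]_(i <- enum I) A i.
  rewrite -bigcup_seq; apply/seteqP; split => w /=.
    by move=> [i Ai]; exists i => //=; rewrite mem_enum.
  by move=> [i _ Ai]; exists i.
rewrite cardE; elim: (enum I) => [|i s [ms ih]].
  by rewrite big_nil measure0 mul0r; split.
rewrite big_cons; split; first exact: measurableU.
apply: le_trans (measureU2 _ _ _) _ => //.
by rewrite /= mulrS mulrDl mul1r EFinD leeD.
Qed.

(** Keeping one term of the exponential series suffices to turn Gaussian tails into decay of any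
    polynomial order. *)
Lemma expRN_le {R : realType} (u : R) (n : nat) :
  0 < u -> expR (- u) <= n.+1`!%:R / u ^+ n.+1.
Proof.
move=> u0; rewrite expRN.
have f0 : 0 < n.+1`!%:R :> R by rewrite ltr0n fact_gt0.
rewrite -[leRHS]invrK lef_pV2 ?posrE ?expR_gt0 ?invr_gt0 ?divr_gt0 ?exprn_gt0//.
by rewrite invf_div; apply: le_trans (expR_ge1Dxn n (ltW u0)); rewrite lerDr.
Qed.

Lemma measurable_stieltjes {R : realType} {disp : measure_display}
    {T : measurableType disp} (m : nat) (M : T -> 'M[R]_m) (z : R[i]) :
  0 < complex.Im z -> (forall w, (M w)^T = M w) ->
  (forall i j, measurable_fun setT (fun w => M w i j)) ->
  measurable_complex (fun w => stieltjes (M w) z).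
Proof.
move=> z0 Ms mM; apply: measurable_complexM; first exact: measurable_complex_cst.
apply: measurable_complex_tr_invmx => [w|i j]; first exact: shifted_unitmx.
under eq_fun do rewrite !mxE.
apply: measurable_complexB; last exact: measurable_complex_cst.
exact: measurable_complex_real.
Qed.

(** The deterministic half of the argument: the resolvent and Gram bounds combine, the entries of
    the limit factor being at most [sqrt (beta m / d)]. *)
Lemma stieltjes_laguerre_close {R : realType} (beta d tau : R) (m : nat)
    (B : 'M[R]_m) (z : R[i]) :
  0 < beta -> 0 < d -> d <= 1 -> 0 <= tau -> 0 < complex.Im z ->
  (forall i j, (i, j) \notin bidiag_support m -> B i j = 0) ->
  (forall i j, `|B i j - infty_bidiag beta d m i j| <= tau) ->
  `|stieltjes (laguerre_mx beta d B) z - stieltjes (laguerre_infty_mx d m) z| <=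
  (4 * d / beta * m%:R^-1 * (complex.Im z ^+ 2)^-1 *
   (2 * tau * Num.sqrt (beta / d * m%:R) + tau ^+ 2))%:C.
Proof.
move=> b0 d0 d1 t0 z0 Bs Bt; rewrite -(laguerre_infty_bidiag m b0 d0 d1).
apply: le_trans (stieltjes_diff_le z0 (laguerre_mx_sym _ _ _) (laguerre_mx_sym _ _ _)) _.
rewrite lecR.
set Y := infty_bidiag beta d m.
have c0 : 0 <= d / (beta * m%:R) by rewrite divr_ge0 ?mulr_ge0 ?ler0n ?(ltW b0) ?(ltW d0).
under eq_bigr do under eq_bigr do
  rewrite /laguerre_mx [X in X - _]mxE [X in _ - X]mxE -mulrBr normrM (ger0_norm c0).
under eq_bigr do rewrite -mulr_sumr.
rewrite -mulr_sumr.
have := @bidiagonal_gram_diff_le R m B Y tau (Num.sqrt (beta / d * m%:R)) t0 (sqrtr_ge0 _) Bs.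
set K := 2 * tau * _ + _.
move=> /(_ _ Bt) h.
have {h} h : \sum_i \sum_j `|(B *m B^T) i j - (Y *m Y^T) i j| <= 4 * m%:R * K.
  apply: h => i j; rewrite mxE.
    by move=> /chi_param_supp ->; rewrite sqrtr0.
  by rewrite ger0_norm ?sqrtr_ge0// ler_wsqrtr// chi_param_le.
(* For [m = 0] both sides carry the inverse of 0, which is 0. *)
have [m0|m0] := posnP m.
  have -> : m%:R = 0 :> R by rewrite m0.
  by rewrite invr0 !(mul0r, mulr0).
have mR : m%:R != 0 :> R by rewrite pnatr_eq0 -lt0n.
have e0 : 0 <= (complex.Im z ^+ 2)^-1 by rewrite invr_ge0 sqr_ge0.
have p0 : 0 <= m%:R^-1 * (complex.Im z ^+ 2)^-1 * (d / (beta * m%:R)).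
  by rewrite mulr_ge0// mulr_ge0// invr_ge0 ler0n.
rewrite mulrA; apply: le_trans (ler_wpM2l p0 h) _.
rewrite le_eqVlt; apply/orP; left; apply/eqP.
by field; rewrite mR !gt_eqF.
Qed.

Theorem proposition2p1 (R : realType) (beta d eps kappa : R)
    (beta_gt0 : 0 < beta) (d_gt0 : 0 < d) (d_le1 : d <= 1)
    (eps_gt0 : 0 < eps) (kappa_gt0 : 0 < kappa) :
  exists C : R, forall k : R, 0 < k -> exists Ck : R,
  forall m : nat, (0 < m)%N ->
  forall (disp : measure_display) (T : measurableType disp)
    (P : probability T R) (B : 'I_m -> 'I_m -> {RV P >-> R}),
  beta_bidiagonal beta d B ->
  forall z : R[i],
  m%:R `^ (- (1 / 4) + eps) < complex.Im z ->
  (1 - Num.sqrt d) ^+ 2 + kappa < complex.Re z ->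
  complex.Re z < (1 + Num.sqrt d) ^+ 2 - kappa ->
  (P [set w | ((C * m%:R `^ (- (eps / 8)))%:C <
       `| stieltjes (laguerre_mx beta d (\matrix_(i, j) B i j w)) z
          - stieltjes (laguerre_infty_mx d m) z |)%R]
   <= (Ck * m%:R `^ (- k))%:E)%E.
Proof.
(* The factor 16 is the 4 of [stieltjes_laguerre_close] times the 4 of [tau_le]; the bracket
   collects the terms linear and quadratic in the entry error. *)
exists (16 * d / beta * (Num.sqrt (beta / d) + 1)) => k k0.
(* [N] is the degree of the term kept in the exponential series; the 2 in [k + 2] pays for the [m^2]
   events of the union bound. *)
pose N := (Num.bound ((k + 2) / eps)).+1.
have Nk : k + 2 <= N%:R * eps.
  have := archi_boundP (divr_ge0 (addr_ge0 (ltW k0) (ler0n _ 2)) (ltW eps_gt0)).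
  rewrite ltr_pdivrMr// => /ltW /le_trans; apply.
  by rewrite ler_wpM2r ?(ltW eps_gt0)// ler_nat.
(* The first 2 counts the two tails; [N! 2^N] comes from [exp (- u) <= N! / u^N] at
   [u = m^eps / 2]. *)
exists (2 * N`!%:R * 2 ^+ N) => m m0 disp T P B HB z zI _ _.
set M : R := m%:R.
have M1 : 1 <= M by rewrite ler1n.
have Mp : 0 < M by exact: lt_le_trans M1.
have Mn : M != 0 by rewrite gt_eqF.
have pD x y : M `^ x * M `^ y = M `^ (x + y) by rewrite powRD// Mn implybT.
have pmono x y : x <= y -> M `^ x <= M `^ y by exact: ler_powR.
have p0 x : 0 < M `^ x by exact: powR_gt0.
pose t := M `^ (eps / 2).
have t1 : 1 <= t by rewrite -[1](powRr0 M); apply: pmono; lra.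
have z0 : 0 < complex.Im z by exact: lt_trans (p0 _) zI.
pose A (p : 'I_m * 'I_m) := [set w | 1 + t <
  `|B p.1 p.2 w - infty_bidiag beta d m p.1 p.2|].
have t0 : 0 <= t by lra.
have AE p : A p = B p.1 p.2 @^-1` [set x | 1 + t <
    `|x - infty_bidiag beta d m p.1 p.2|] by [].
have mA p : measurable (A p).
  rewrite AE; apply: measurable_sfunP.
  rewrite -[X in measurable X]setTI; apply: measurable_fun_ltr => //.
  by apply: measurableT_comp => //; exact: measurable_funD.
have PA p : (P (A p) <= (2 * expR (- (t ^+ 2 / 2)))%:E)%E.
  case: p => i j; rewrite /A/= mxE.
  case: (boolP ((i, j) \in bidiag_support m)) => ij.
    apply: chi_concentration t0; last exact: chi_param_ge0.
    move: ij; rewrite inE/= => /orP[/eqP <-|/eqP ij].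
      by rewrite /chi_param eqxx; exact: (bidiag_diag HB).
    by rewrite /chi_param ij gtn_eqF// eqxx; exact: (bidiag_sub HB).
  (* Off the support both entries are 0 and the event is empty. *)
  rewrite (_ : [set w | _] = set0) ?measure0 ?lee_fin ?mulr_ge0 ?expR_ge0//.
  apply/seteqP; split => w //=.
  rewrite (bidiag_zero HB)// chi_param_supp// sqrtr0 subrr normr0 => ?; lra.
have [mU PU] := measure_exists_le mA PA.
apply: (@le_trans _ _ (P [set w | exists p, A p w])).
  (* Measurability is needed here: the value of P on a nonmeasurable set is
     unconstrained. *)
  apply: le_measure; rewrite ?inE//.
    apply: measurable_normc_gt; apply: measurable_complexB; last exact: measurable_complex_cst.
    apply: measurable_stieltjes => // [w|i j]; first exact: laguerre_mx_sym.
    rewrite /laguerre_mx; under eq_fun do rewrite !mxE.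
    apply: measurable_funM => //; apply: measurable_sum => l.
    by under eq_fun do rewrite !mxE; exact: measurable_funM.
  move=> w /=; apply: contraPP => nA.
  apply/negP; rewrite le_gtF//.
  apply: le_trans (@stieltjes_laguerre_close _ _ _ (1 + t) _ _ _
    beta_gt0 d_gt0 d_le1 _ z0 _ _) _.
  - lra.
  - by move=> i j ij; rewrite mxE (bidiag_zero HB).
  - move=> i j; rewrite leNgt mxE; apply/negP => Aw.
    by apply: nA; exists (i, j).
  rewrite lecR.
  have eta : (complex.Im z ^+ 2)^-1 <= M `^ (1 / 2 - 2 * eps).
    have -> : 1 / 2 - 2 * eps = - (- (1 / 4) + eps + (- (1 / 4) + eps)) by lra.
    rewrite powRN -pD -expr2 lef_pV2 ?posrE ?exprn_gt0//.
    by rewrite ler_sqr ?nnegrE ?ltW.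
  have sqrtM : Num.sqrt (beta / d * M) = Num.sqrt (beta / d) * M `^ (1 / 2).
    by rewrite sqrtrM ?divr_ge0 ?ltW// div1r powR12_sqrt// ltW.
  have Mv : M^-1 = M `^ (-1) by rewrite powR_inv1// ltW.
  have s0 : 0 <= Num.sqrt (beta / d) by exact: sqrtr_ge0.
  (* From [t >= 1] one gets [1 + t <= 2 t], used once in the linear term and twice in the square. *)
  have tau_le : 2 * (1 + t) * Num.sqrt (beta / d * M) + (1 + t) ^+ 2 <=
      4 * (Num.sqrt (beta / d) * M `^ ((1 + eps) / 2) + M `^ eps).
    have -> : (1 + eps) / 2 = eps / 2 + 1 / 2 by lra.
    have -> : M `^ eps = t * t by rewrite pD; congr (_ `^ _); lra.
    rewrite sqrtM -pD -/t.
    have h : 0 <= Num.sqrt (beta / d) * M `^ (1 / 2) by rewrite mulr_ge0// ltW.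
    by nra.
  have c0 : 0 <= 4 * d / beta by rewrite divr_ge0 ?mulr_ge0 ?ltW.
  apply: (@le_trans _ _ (4 * d / beta * M^-1 * M `^ (1 / 2 - 2 * eps) *
      (4 * (Num.sqrt (beta / d) * M `^ ((1 + eps) / 2) + M `^ eps)))).
    apply: ler_pM => //.
    - by rewrite !mulr_ge0 ?invr_ge0 ?sqr_ge0// ltW.
    - by rewrite addr_ge0 ?sqr_ge0 ?mulr_ge0 ?sqrtr_ge0//; lra.
    - by rewrite ler_wpM2l// mulr_ge0// invr_ge0 ltW.
  have -> : 4 * d / beta * M^-1 * M `^ (1 / 2 - 2 * eps) *
      (4 * (Num.sqrt (beta / d) * M `^ ((1 + eps) / 2) + M `^ eps)) =
      16 * d / beta * (Num.sqrt (beta / d) *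
        (M `^ (-1) * M `^ (1 / 2 - 2 * eps) * M `^ ((1 + eps) / 2)) +
        M `^ (-1) * M `^ (1 / 2 - 2 * eps) * M `^ eps).
    by rewrite Mv; ring.
  rewrite !pD -[leRHS]mulrA; apply: ler_wpM2l.
    by rewrite divr_ge0 ?mulr_ge0 ?ltW.
  (* The exponents add up to [- 3 eps / 2] and [- 1 / 2 - eps], both at most [- eps / 8]. *)
  by rewrite [leRHS]mulrDl [X in _ <= _ + X]mul1r; apply: lerD;
    [apply: ler_wpM2l => //|]; apply: pmono; lra.
apply: le_trans PU _; rewrite lee_fin card_prod card_ord natrM -/M.
have t2 : t ^+ 2 = M `^ eps.
  by rewrite expr2 pD; congr (_ `^ _); lra.
have u0 : 0 < t ^+ 2 / 2 by rewrite t2 divr_gt0.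
have := expRN_le (Num.bound ((k + 2) / eps)) u0; rewrite -/N => hE.
have hE' : expR (- (t ^+ 2 / 2)) <= N`!%:R * 2 ^+ N * M `^ (- (eps * N%:R)).
  apply: le_trans hE _; rewrite t2 powRN powRrM powR_mulrn ?(ltW (p0 _))//.
  by rewrite exprMn exprVn invfM invrK; lra.
have M2 : M * M = M `^ 2 by rewrite -[2]/(2%:R) powR_mulrn ?(ltW Mp).
apply: le_trans (ler_wpM2l _ (ler_wpM2l _ hE')) _ => //.
  by rewrite M2 ltW.
rewrite [leLHS](_ : _ = 2 * N`!%:R * 2 ^+ N * (M `^ 2 * M `^ (- (eps * N%:R)))).
  rewrite pD; apply: ler_wpM2l; first by rewrite mulr_ge0 ?exprn_ge0// mulr_ge0// ler0n.
  (* This is [2 - eps N <= - k], the choice of [N]. *)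
  by apply: pmono; lra.
by rewrite M2; ring.
Qed.
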